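(* Let $n=ks$ with $s\geq2$, and let $\mathcal{F}$ be a flag on $\mathbb{F}_q^n$ of type $(1,\dots,k,n-k,\dots,n-1)$ such that its $k$-dimensional subspace $\mathcal{F}_k$ belongs to $\mathcal{S}$ and its $(n-k)$-dimensional subspace $\mathcal{F}_{n-k}$ belongs to $\mathcal{H}$. For a positive integer $t$ dividing $q^n-1$, let $\mathbf{T}$ be the unique subgroup of order $t$ of the cyclic group $\langle\psi(M_s)\rangle$. Then: (i) $|\mathrm{Orb}_{\mathbf{T}}(\mathcal{F})|=\frac{t}{\gcd(t,q-1)}$; (ii) $\mathrm{Orb}_{\mathbf{T}}(\mathcal{F})$ is an optimum distance flag code if and only if $\gcd(t,q^k-1)=\gcd(t,q-1)\neq t$.
   Context: Let $\omega$ be a primitive element of $\mathbb{F}_{q^k}$, with minimal polynomial $p(x)$ over $\mathbb{F}_q$ of degree $k$ and companion matrix $M_k\in\mathrm{GL}(k,q)$; then $\phi:\mathbb{F}_{q^k}=\mathbb{F}_q[\omega]\to\mathbb{F}_q[M_k]$, $\sum_i a_i\omega^i\mapsto\sum_i a_iM_k^i$ ($a_i\in\mathbb{F}_q$) is a field isomorphism onto a set of $k\times k$ matrices. For a matrix $A=(a_{ij})$ over $\mathbb{F}_{q^k}$, let $\psi(A)$ (resp. for a subspace $\mathrm{rowsp}(A)$ of $\mathbb{F}_{q^k}^s$, $\varphi(\mathrm{rowsp}(A))$) be the block matrix $(\phi(a_{ij}))$ over $\mathbb{F}_q$ (resp. its row space in $\mathbb{F}_q^{ks}$); $\psi:\mathrm{GL}(s,q^k)\to\mathrm{GL}(ks,q)$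 is a group monomorphism and $\varphi$ maps $m$-dimensional $\mathbb{F}_{q^k}$-subspaces of $\mathbb{F}_{q^k}^s$ injectively to $km$-dimensional subspaces of $\mathbb{F}_q^{ks}$. Let $\alpha$ be a primitive element of $\mathbb{F}_{q^n}$ and $M_s\in\mathrm{GL}(s,q^k)$ the companion matrix of the minimal polynomial of $\alpha$ over $\mathbb{F}_{q^k}$; $\langle\psi(M_s)\rangle$ is a cyclic subgroup of $\mathrm{GL}(n,q)$ of order $q^n-1$. Define $\mathcal{S}=\{\varphi(l)\mid l\text{ a 1-dim subspace of }\mathbb{F}_{q^k}^s\}$ (a $k$-spread of $\mathbb{F}_q^n$) and $\mathcal{H}=\{\varphi(h)\mid h\text{ an }(s-1)\text{-dim subspace of }\mathbb{F}_{q^k}^s\}$. A flag of type $(1,\dots,k,n-k,\dots,n-1)$ is a chain of subspaces of $\mathbb{F}_q^n$ with these dimensions (listed increasingly, with the dimension $k=n-k$ appearing once if $s=2$). $\mathrm{GL}(n,q)$ acts on subspaces by $\mathcal{V}\cdot A=\mathrm{rowsp}(VA)$ and on flags componentwise; $\mathrm{Orb}_{\mathbf{T}}$ is the orbit. With $d_S(\mathcal{U},\mathcal{V})=\dim(\mathcal{U}+\mathcal{V})-\dim(\mathcal{U}\cap\mathcal{V})$ and $d_f(\mathcal{F},\mathcal{F}')=\sum_i d_S(\mathcal{F}_i,\mathcal{F}'_i)$, a flag code $\mathcal{C}$ of type $(t_1,\dots,t_r)$ is an optimum distance flag code if its minimum flag distance (defined as $0$ if $|\mathcal{C}|=1$)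 equals $2\left(\sum_{2t_i\leq n}t_i+\sum_{2t_i>n}(n-t_i)\right)$. *)

(* Defs.v *)
From HB Require Import structures.
From mathcomp Require Import all_boot all_order all_fingroup all_algebra all_field.

Set Implicit Arguments.
Unset Strict Implicit.
Unset Printing Implicit Defensive.

Import GRing.Theory.
Local Open Scope ring_scope.

Definition primitive_element (K : fieldType) (w : K) : Prop :=
  w != 0 /\ forall x : K, x != 0 -> exists i : nat, x = w ^+ i.

(* [companionmx p] has size [(size p).-1]; [conform_mx] retypes it to size [d]
   when [p] has degree [d] (and is [0] otherwise). *)
Definition companion (K : fieldType) (d : nat) (p : {poly K}) : 'M[K]_d :=
  conform_mx 0 (companionmx p).

Section Subspaces.

Variable K : fieldType.

Definition rowsp (m n : nat) (A : 'M[K]_(m, n)) : {vspace 'rV[K]_n} :=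
  <<[seq row i A | i : 'I_m]>>%VS.

Definition basis_mx (n : nat) (U : {vspace 'rV[K]_n}) : 'M[K]_(\dim U, n) :=
  \matrix_(i < \dim U) (vbasis U)`_i.

Definition subspace_act (n : nat) (U : {vspace 'rV[K]_n}) (A : 'M[K]_n) :
  {vspace 'rV[K]_n} := rowsp (basis_mx U *m A).

Definition subspace_dist (n : nat) (U V : {vspace 'rV[K]_n}) : nat :=
  (\dim (U + V)%VS - \dim (U :&: V)%VS)%N.

End Subspaces.

Section VspaceFinite.

(* The subtype structure of [{vspace vT}] is only exposed in this module. *)
Import VectorInternalTheory.

Variables (F : finFieldType) (vT : vectType F).

HB.instance Definition _ := [Countable of {vspace vT} by <:].
HB.instance Definition _ := [Finite of {vspace vT} by <:].

End VspaceFinite.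

Section FieldReduction.

Variables (F : finFieldType) (K : fieldExtType F) (k : nat).
(* [w] is the primitive element of [K], [p] its minimal polynomial over [F]. *)
Variables (w : K) (p : {poly F}).

Definition phi (x : K) : 'M[F]_k :=
  \sum_(i < k) coord [tuple w ^+ j | j < k] i x *: companion k p ^+ i.

Lemma sum_block_size (m : nat) : (\sum_(i < m) k)%N = (k * m)%N.
Proof. by rewrite sum_nat_const card_ord mulnC. Qed.

Definition psi (m s : nat) (A : 'M[K]_(m, s)) : 'M[F]_(k * m, k * s) :=
  castmx (sum_block_size m, sum_block_size s)
    (\mxblock_(i < m, j < s) phi (A i j)).

(* When [K = F(w)] has degree [k], any matrix with row space [W] gives the same
   subspace as [basis_mx W]. *)
Definition varphi (s : nat) (W : {vspace 'rV[K]_s}) :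
  {vspace 'rV[F]_(k * s)} := rowsp (psi (basis_mx W)).

Definition in_varphi_image (s d : nat) (U : {vspace 'rV[F]_(k * s)}) : Prop :=
  exists2 W : {vspace 'rV[K]_s}, \dim W = d & U = varphi W.

Definition in_spread (s : nat) (U : {vspace 'rV[F]_(k * s)}) : Prop :=
  in_varphi_image 1 U.

Definition in_hyperplanes (s : nat) (U : {vspace 'rV[F]_(k * s)}) : Prop :=
  in_varphi_image s.-1 U.

End FieldReduction.

Section FlagCodes.

Variables (F : finFieldType) (n : nat) (ty : seq nat).

(* Sequences of [size ty] subspaces; [is_flag] cuts out the flags of type [ty]. *)
Definition preflag := (size ty).-tuple {vspace 'rV[F]_n}.

Definition is_flag (Fl : preflag) : Prop :=
  [seq \dim U | U <- Fl] = ty /\ sorted (fun U V => (U <= V)%VS) Fl.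

Definition flag_component (Fl : preflag) (d : nat) : {vspace 'rV[F]_n} :=
  nth 0%VS Fl (index d ty).

(* The underlying matrix of an element of [{'GL_n[F]}] has type
   ['M[F]_n.-1.+1], which is retyped to ['M[F]_n]; this is only meaningful
   for [0 < n]. *)
Definition GL_mx (g : {'GL_n[F]}) : 'M[F]_n := conform_mx 0 (val g).

Definition flag_act (Fl : preflag) (g : {'GL_n[F]}) : preflag :=
  [tuple of [seq subspace_act U (GL_mx g) | U <- Fl]].

Definition flag_orbit (T : {set {'GL_n[F]}}) (Fl : preflag) : {set preflag} :=
  [set flag_act Fl g | g in T].

Definition flag_dist (Fl Fl' : preflag) : nat :=
  (\sum_(i < size ty) subspace_dist (tnth Fl i) (tnth Fl' i))%N.

(* The least distance between distinct elements, and [0] if there are none. *)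
Definition min_flag_dist (C : {set preflag}) : nat :=
  head 0%N (sort leq
    [seq flag_dist P.1 P.2
       | P : preflag * preflag
          in [pred P | [&& P.1 \in C, P.2 \in C & P.1 != P.2]]]).

Definition optimum_distance (C : {set preflag}) : Prop :=
  min_flag_dist C =
    (2 * (\sum_(t <- ty | 2 * t <= n) t + \sum_(t <- ty | 2 * t > n) (n - t)))%N.

End FlagCodes.

(* (1, ..., k, n - k, ..., n - 1); [undup] merges the two occurrences of [k]
   when [n = 2 * k]. *)
Definition full_type (k n : nat) : seq nat :=
  undup (iota 1 k ++ iota (n - k) k).

(* Main.v *)
(** Coordinates in the bases of powers of [w] and [alpha] identify ['rV[F]_(k * s)]
    with [L], so that [g] becomes multiplication by [alpha], the elements of [T]
    become multiplications by nonzero elements of [L], and the images under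
    [varphi] become the [K]-subspaces of [L]. An element [b] stabilising the line
    [F_1] is an eigenvalue, hence lies in [F], and elements of [F] fix every
    subspace: the stabiliser of the flag is [{h in T | h ^+ (q - 1) = 1}], of
    order [gcd(t, q - 1)]. If [y / x] is not in [K], then the translates [lx], [ly]
    of a [K]-line meet trivially and the translates [Hx], [Hy] of a [K]-hyperplane
    span [L]; these two extreme cases force maximal distance for all smaller,
    resp. larger, components. If [y / x] is in [K], the distance at dimension [k]
    vanishes. Hence the orbit is an optimum distance code iff it has two elements
    and [h ^+ (q ^ k - 1) = 1] implies [h ^+ (q - 1) = 1] on [T], which is compared
    by counting in the cyclic group [T]. *)

Require Import Defs.
From HB Require Import structures.
From mathcomp Require Import all_boot all_order all_fingroup all_algebra all_field.
From mathcomp Require Import cyclic action zify.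

Set Implicit Arguments.
Unset Strict Implicit.
Unset Printing Implicit Defensive.

Import GRing.Theory.
Local Open Scope ring_scope.

(** * Companion matrices and coordinates in the powers of a primitive element *)

Lemma companionE (K : fieldType) (d : nat) (p : {poly K}) (i j : 'I_d) :
  size p = d.+1 ->
  companion d p i j = if i.+1 == d then - p`_j else (i.+1 == j)%:R.
Proof.
move=> sz; have ed : d = (size p).-1 by rewrite sz.
rewrite /companion; move: i j; rewrite {}ed => i j; rewrite conform_mx_id mxE.
by rewrite -(eqn_add2r 1) !addn1 prednK // (leq_ltn_trans _ (ltn_ord i)).
Qed.

Section PowerBasis.

Variables (K : fieldType) (E : fieldExtType K) (d : nat) (z : E) (p : {poly K}).
Hypotheses (dimE : \dim {:E} = d) (z_prim : primitive_element z).
Hypothesis p_min : map_poly (in_alg E) p = minPoly 1%VS z.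

Definition horner_row (v : 'rV[K]_d) : E := \sum_(i < d) v 0 i *: z ^+ i.

Definition coord_row (x : E) : 'rV[K]_d :=
  \row_i coord [tuple z ^+ j | j < d] i x.

Lemma adjoin_primitive : <<1; z>>%VS = fullv :> {vspace E}.
Proof.
apply/eqP; rewrite eqEsubv subvf; apply/subvP=> x _.
have [-> | x0] := eqVneq x 0; first exact: mem0v.
have [i ->] := (proj2 z_prim) _ x0.
by rewrite rpredX // memv_adjoin.
Qed.

Lemma adjoin_degree_primitive : adjoin_degree 1%AS z = d.
Proof. by rewrite adjoin_degreeE adjoin_primitive dimv1 divn1. Qed.

Lemma size_min : size p = d.+1.
Proof.
by rewrite -(size_map_poly (in_alg E)) p_min size_minPoly adjoin_degree_primitive.
Qed.

(** Each element is the value at [z] of a polynomial of degree less than [d], so the [d] powers span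
    a space of dimension [d]. *)
Lemma powers_basis : basis_of {:E} [tuple z ^+ j | j < d].
Proof.
rewrite basisEdim size_tuple dimE leqnn andbT; apply/subvP=> x _.
have xz : x \in <<1; z>>%VS by rewrite adjoin_primitive memvf.
have sz := size_Fadjoin_poly 1%AS z x; rewrite adjoin_degree_primitive in sz.
rewrite -(Fadjoin_poly_eq xz) (horner_coef_wide _ sz).
apply: memv_suml => i _.
have /polyOverP/(_ i)/vlineP[c ->] := Fadjoin_polyOver 1%AS z x.
rewrite mulr_algl memvZ // memv_span //.
by apply/mapP; exists i; rewrite ?mem_enum.
Qed.

Lemma coord_rowK : cancel coord_row horner_row.
Proof.
move=> x; rewrite [RHS](coord_basis powers_basis (memvf x)).
by apply: eq_bigr => i _; rewrite mxE (nth_mktuple _ 0).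
Qed.

Lemma horner_rowK : cancel horner_row coord_row.
Proof.
move=> v; apply/rowP=> i; rewrite mxE /horner_row.
transitivity (coord [tuple z ^+ j | j < d] i
  (\sum_(j < d) v 0 j *: [tuple z ^+ j | j < d]`_j)).
  by congr (coord _ _ _); apply: eq_bigr => j _; rewrite (nth_mktuple _ 0).
by rewrite coord_sum_free // (basis_free powers_basis).
Qed.

Lemma horner_rowP : linear horner_row.
Proof.
move=> a u v; rewrite /horner_row scaler_sumr -big_split /=.
by apply: eq_bigr => i _; rewrite !mxE scalerDl scalerA.
Qed.

HB.instance Definition _ := GRing.isLinear.Build K 'rV[K]_d E *:%R horner_row horner_rowP.

(** The column of powers of [z] is an eigenvector of the companion matrix for [z]: all rows but the
    last shift the powers, and the last one expresses [z ^+ d] through the monic relation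
    [p(z) = 0]. *)
Lemma companion_row_horner (i : 'I_d) :
  \sum_(j < d) companion d p i j *: z ^+ j = z ^+ i.+1.
Proof.
under eq_bigr => j _ do rewrite (companionE _ _ size_min).
case: eqP => [-> | /eqP ne].
  have mon : lead_coef (map_poly (in_alg E) p) = 1.
    by rewrite p_min; apply/eqP; exact: monic_minPoly.
  have := minPolyxx 1%AS z; rewrite -p_min horner_coef.
  move: mon; rewrite lead_coefE size_map_poly size_min /= => mon.
  rewrite big_ord_recr /= mon mul1r => /eqP; rewrite addrC addr_eq0 => /eqP->.
  rewrite -sumrN; apply: eq_bigr => j _.
  by rewrite coef_map /= mulr_algl scaleNr.
have lt : (i.+1 < d)%N by rewrite ltn_neqAle ne ltn_ord.
rewrite (bigD1 (Ordinal lt)) //= eqxx scale1r big1 ?addr0 // => j nj.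
by case: eqP => [e|]; rewrite ?scale0r //; case/eqP: nj; apply: val_inj.
Qed.

Lemma horner_row_companion (v : 'rV[K]_d) :
  horner_row (v *m companion d p) = horner_row v * z.
Proof.
rewrite /horner_row mulr_suml.
under eq_bigr => j _ do rewrite mxE scaler_suml.
rewrite exchange_big; apply: eq_bigr => i _ /=.
under eq_bigr => j _ do rewrite -scalerA.
by rewrite -scaler_sumr companion_row_horner -scalerAl exprSr.
Qed.

(** The case of a power of [z] extends linearly to [y]. The sum is the body of [phi], written out
    because the base field here is not assumed finite. *)
Lemma horner_row_phi (v : 'rV[K]_d) (y : E) :
  horner_row (v *m \sum_(i < d) coord [tuple z ^+ j | j < d] i y *: companion d p ^+ i)
    = horner_row v * y.
Proof.
have horner_rowX n : horner_row (v *m companion d p ^+ n) = horner_row v * z ^+ n.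
  elim: n => [|n IHn]; first by rewrite !expr0 mulr1 [X in _ *m X]/1 /= mulmx1.
  by rewrite !exprSr mulrA -IHn -horner_row_companion mulmxA.
rewrite [y in RHS](coord_basis powers_basis (memvf y)) mulmx_sumr linear_sum mulr_sumr.
apply: eq_bigr => i _.
by rewrite -scalemxAr linearZ /= horner_rowX -scalerAr (nth_mktuple _ 0).
Qed.

End PowerBasis.

(** * Row spaces and the action of matrices on subspaces *)

Section RowSpace.

Variables (K : fieldType) (n : nat).
Implicit Types (U V : {vspace 'rV[K]_n}) (A B : 'M[K]_n).

Lemma memv_rowsp (m : nat) (A : 'M[K]_(m, n)) (u : 'rV[K]_n) :
  reflect (exists v : 'rV[K]_m, u = v *m A) (u \in rowsp A).
Proof.
apply: (iffP idP) => [|[v ->]]; last first.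
  rewrite mulmx_sum_row; apply: memv_suml => i _.
  by rewrite memvZ // memv_span // image_f.
rewrite /rowsp span_def big_image /= => /memv_sumP[f fP ->].
have {}fP i : {c | f i = c *: row i A}.
  by apply: sig_eqW; have /vlineP[c ->] := fP i isT; exists c.
exists (\row_i sval (fP i)); rewrite mulmx_sum_row; apply: eq_bigr => i _.
by rewrite mxE; exact: svalP (fP i).
Qed.

Lemma rowsp_basis_mx U : rowsp (basis_mx U) = U.
Proof.
rewrite /rowsp -[RHS](span_basis (vbasisP U)); congr (span _).
apply: (@eq_from_nth _ 0); first by rewrite size_image card_ord size_tuple.
move=> i; rewrite size_image card_ord => lti.
rewrite (nth_map (Ordinal lti)) ?size_enum_ord // -[i in RHS]/(val (Ordinal lti)).
by rewrite -[X in nth _ _ X]/(val (Ordinal lti)) nth_ord_enum; apply/rowP=> j; rewrite !mxE.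
Qed.

Lemma memv_basis_mx U (u : 'rV[K]_n) :
  reflect (exists v, u = v *m basis_mx U) (u \in U).
Proof. by have := memv_rowsp (basis_mx U) u; rewrite rowsp_basis_mx. Qed.

(** Frees the action from the chosen basis, so that it can be handled as an image under a linear
    map. *)
Lemma subspace_actE U A : subspace_act U A = (linfun (mulmxr A) @: U)%VS.
Proof.
apply/vspaceP=> u; apply/memv_rowsp/memv_imgP=> [[v ->]|[v]].
  exists (v *m basis_mx U); first by apply/memv_basis_mx; exists v.
  by rewrite lfunE /= mulmxA.
by case/memv_basis_mx=> x -> ->; exists x; rewrite lfunE /= mulmxA.
Qed.

Lemma memv_subspace_act U A (u : 'rV[K]_n) :
  reflect (exists2 v, v \in U & u = v *m A) (u \in subspace_act U A).
Proof.
rewrite subspace_actE; apply: (iffP memv_imgP) => -[v Uv ->]; exists v => //.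
  by rewrite lfunE.
by rewrite lfunE.
Qed.

Lemma subspace_act1 U : subspace_act U 1%:M = U.
Proof. by rewrite /subspace_act mulmx1 rowsp_basis_mx. Qed.

Lemma subspace_actM U A B :
  subspace_act U (A *m B) = subspace_act (subspace_act U A) B.
Proof.
rewrite !subspace_actE -limg_comp; congr (_ @: _)%VS.
by apply/lfunP=> u; rewrite !lfunE /= !lfunE /= mulmxA.
Qed.

Lemma subspace_actS U V A : (U <= V)%VS -> (subspace_act U A <= subspace_act V A)%VS.
Proof. by rewrite !subspace_actE; apply: limgS. Qed.

Lemma dim_subspace_act U A : A \in unitmx -> \dim (subspace_act U A) = \dim U.
Proof.
move=> uA; rewrite subspace_actE limg_dim_eq //.
apply/eqP; rewrite -subv0; apply/subvP=> u /memv_capP[_].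
by rewrite memv_ker lfunE /= memv0 => /eqP uA0; rewrite -[u](mulmxK uA) uA0 mul0mx.
Qed.

Lemma subspace_act_scalar U A (c : K) :
  c != 0 -> (forall u : 'rV_n, u *m A = c *: u) -> subspace_act U A = U.
Proof.
move=> c0 Ac; apply/vspaceP=> u; apply/memv_subspace_act/idP.
  by case=> v Uv ->; rewrite Ac memvZ.
move=> Uu; exists (c^-1 *: u); first by rewrite memvZ.
by rewrite Ac scalerA divff ?scale1r.
Qed.

End RowSpace.

(** * Field reduction read backwards *)

Lemma mulmx_castmx (R : pzSemiRingType) (m m' n n' : nat) (em : m = m') (en : n = n')
    (u : 'rV[R]_m') (A : 'M[R]_(m, n)) :
  u *m castmx (em, en) A
    = castmx (erefl, en) (castmx (erefl, esym em) u *m A).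
Proof. by move: u; case: m' / em; case: n' / en. Qed.

Section FieldReductionTheory.

Variables (F : finFieldType) (K : fieldExtType F) (k : nat) (w : K) (p : {poly F}).
Hypotheses (dimK : \dim {:K} = k) (w_prim : primitive_element w).
Hypothesis p_min : map_poly (in_alg K) p = minPoly 1%VS w.

(* The inverse of field reduction: [s] blocks of [k] coordinates over [F] are
   read as [s] elements of [K]. *)
Definition unreduce (s : nat) (u : 'rV[F]_(k * s)) : 'rV[K]_s :=
  \row_j horner_row w (submxrow (castmx (erefl, esym (sum_block_size k s)) u) j).

(** This is [F]-linearity; the scalar is embedded by [in_alg] because the target is a space over
    [K]. *)
Lemma unreduceP s (a : F) (u v : 'rV[F]_(k * s)) :
  unreduce (a *: u + v) = in_alg K a *: unreduce u + unreduce v.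
Proof.
rewrite /unreduce; case: (k * s)%N / (sum_block_size k s) u v => u v.
apply/rowP=> j; rewrite !mxE !castmx_id /= mulr_algl -linearP; congr horner_row.
by apply/rowP=> i; rewrite !mxE.
Qed.

(** Each block [phi (A i j)] acts on coordinates as multiplication by [A i j], so block
    multiplication becomes matrix multiplication over [K]. *)
Lemma unreduce_psi m s (u : 'rV[F]_(k * m)) (A : 'M[K]_(m, s)) :
  unreduce (u *m psi k w p A) = unreduce u *m A.
Proof.
rewrite /unreduce /psi mulmx_castmx castmx_comp castmx_id.
set v := castmx _ u; rewrite -[v in LHS]submxrowK mul_mxrow_mxblock.
apply/rowP=> j; rewrite !mxE mxrowK linear_sum; apply: eq_bigr => i _ /=.
by rewrite mxE /phi (horner_row_phi dimK w_prim p_min).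
Qed.

Lemma unreduce_inj s : injective (@unreduce s).
Proof.
move=> u v /rowP eq_uv; apply: (can_inj (castmxK (erefl 1%N) (esym (sum_block_size k s)))).
apply/mxrowP => j; have := eq_uv j; rewrite !mxE.
exact: (can_inj (horner_rowK dimK w_prim)).
Qed.

Lemma unreduce_surj s (x : 'rV[K]_s) : exists u : 'rV[F]_(k * s), unreduce u = x.
Proof.
exists (castmx (erefl, sum_block_size k s) (\mxrow_j coord_row k w (x 0 j))).
rewrite /unreduce castmx_comp castmx_id; apply/rowP=> j.
by rewrite mxE mxrowK (coord_rowK dimK w_prim).
Qed.

(** Coefficient rows over [F] of length [k * \dim W] correspond bijectively to coefficient rows over
    [K] of length [\dim W]. *)
Lemma memv_varphi s (W : {vspace 'rV[K]_s}) (u : 'rV[F]_(k * s)) :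
  (u \in varphi k w p W) = (unreduce u \in W).
Proof.
apply/memv_rowsp/memv_basis_mx => [[v ->]|[v]].
  by exists (unreduce v); rewrite unreduce_psi.
have [v' <-] := unreduce_surj v => eq_uv; exists v'.
by apply: unreduce_inj; rewrite unreduce_psi.
Qed.

End FieldReductionTheory.

(** * Solutions of [x ^+ m = 1] in cyclic groups and in fields *)

Lemma dvdn_subn_expn (q k : nat) : (q - 1 %| q ^ k - 1)%N.
Proof. by rewrite !subn1 dvdn_pred_predX. Qed.

(** With [y] a generator and [d] the gcd, the solutions form the subgroup generated by [y ^+ (#[y]
    %/ d)]. *)
Lemma card_expg_eq1 (gT : finGroupType) (T : {group gT}) (m : nat) :
  cyclic T -> #|[set x in T | x ^+ m == 1]%g| = gcdn #|T| m.
Proof.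
case/cyclicP=> y defT; rewrite defT -orderE.
have o0 := order_gt0 y; set d := gcdn _ _.
have d_dvd : (d %| #[y]%g)%N by apply: dvdn_gcdl.
have d0 : (0 < d)%N by rewrite gcdn_gt0 o0.
have -> : [set x in <[y]> | x ^+ m == 1]%g = <[y ^+ (#[y] %/ d)]>%g.
  apply/setP=> x; rewrite inE; apply/andP/idP.
    case=> /cycleP[i ->]; rewrite -expgM -order_dvdn => dv.
    suff /dvdnP[j ->] : (#[y]%g %/ d %| i)%N by rewrite mulnC expgM mem_cycle.
    (* [i * d] is the gcd of [i * #[y]] and [i * m], both multiples of [#[y]]. *)
    by rewrite dvdn_divLR // /d muln_gcdr dvdn_gcd dvdn_mull.
  case/cycleP=> i ->; rewrite -!expgM mem_cycle; split=> //.
  rewrite -order_dvdn mulnAC dvdn_mulr // -[X in (X %| _)%N](divnK d_dvd).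
  by rewrite dvdn_mul // dvdn_gcdr.
by rewrite -orderE orderXdiv ?divn_dvd // ?divnA // ?mulKn //; rewrite ?dvdn_div.
Qed.

(** Over [R], [X ^ #|R| - X] is the product of all [X - c], so its roots in [E] are the images
    [f c]. *)
Lemma finField_fixed_image (R : finFieldType) (E : fieldType) (f : {rmorphism R -> E}) (x : E) :
  x ^+ #|R| = x -> exists c : R, x = f c.
Proof.
move=> xq; have : root (map_poly f ('X^#|R| - 'X)) x.
  by rewrite rmorphB /= map_polyXn map_polyX rootE !hornerE xq subrr.
rewrite finField_genPoly rmorph_prod rootE horner_prod prodf_seq_eq0 => /hasP[c _] /=.
by rewrite rmorphB /= map_polyX map_polyC /= -rootE root_XsubC => /eqP->; exists c.
Qed.

Lemma expf_card_pred (R : finFieldType) (c : R) : c != 0 -> c ^+ (#|R| - 1) = 1.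
Proof.
move=> c0; apply: (mulIf c0); rewrite mul1r -exprSr subn1 prednK ?expf_card //.
exact: ltnW (finNzRing_gt1 R).
Qed.

Lemma expf_pred_image (R : finFieldType) (E : fieldType) (f : {rmorphism R -> E}) (x : E) :
  x ^+ (#|R| - 1) = 1 -> exists c : R, x = f c.
Proof.
move=> xq; apply: finField_fixed_image.
by rewrite -[in LHS](prednK (ltnW (finNzRing_gt1 R))) exprSr -subn1 xq mul1r.
Qed.

Section ExtensionOfFinite.

Variables (F : finFieldType) (K : fieldExtType F) (L : fieldExtType K).

Lemma card_finvect_type : #|finvect_type K| = (#|F| ^ \dim {:K})%N.
Proof.
pose cK := Vector.class (finvect_type K : vectType F).
by rewrite -(@card_vspacef F _ cK); exact: (@card_vspace F _ cK).
Qed.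

(** Recognises the nonzero elements of [K] inside [L] by their order; [finvect_type K] is [K] with
    its finite field structure. *)
Lemma expf_pred_subfield (x : L) :
  x ^+ (#|F| ^ \dim {:K} - 1) = 1 <-> x != 0 /\ exists c : K, x = c%:A.
Proof.
rewrite -card_finvect_type; split=> [xq|[x0 [c xc]]].
  split; last exact: (expf_pred_image (in_alg L : {rmorphism finvect_type K -> L}) xq).
  apply: contra_eq_neq xq => ->; rewrite expr0n subn_eq0 leqNgt.
  by rewrite finNzRing_gt1 eq_sym oner_eq0.
have c0 : c != 0 by apply: contraNneq x0 => c0; rewrite xc c0 scale0r.
rewrite xc -[RHS](rmorph1 (in_alg L)) -(@expf_card_pred (finvect_type K) c c0).
by rewrite -(rmorphXn (in_alg L)).
Qed.

Lemma expf_pred_base (x : L) :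
  x ^+ (#|F| - 1) = 1 <-> x != 0 /\ exists c : F, x = (c%:A : K)%:A.
Proof.
split=> [xq|[x0 [c xc]]].
  split; last exact: (expf_pred_image (in_alg L \o in_alg K) xq).
  apply: contra_eq_neq xq => ->; rewrite expr0n subn_eq0 leqNgt.
  by rewrite finNzRing_gt1 eq_sym oner_eq0.
have c0 : c != 0 by apply: contraNneq x0 => c0; rewrite xc c0 !scale0r.
by rewrite xc -(rmorphXn (in_alg L)) -(rmorphXn (in_alg K)) /= expf_card_pred // !scale1r.
Qed.

End ExtensionOfFinite.

(** * Translates of a hyperplane of a field extension *)

Lemma hyperplane_add (K : fieldType) (V : vectType K) (H : {vspace V}) (v : V) :
  \dim {:V} = (\dim H).+1 -> v \notin H -> (H + <[v]>)%VS = fullv.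
Proof.
move=> dimH vH; apply/eqP; rewrite eqEdim subvf dimH ltnNge.
rewrite (geq_leqif (dimv_leqif_sup (addvSl _ _))) subv_add subvv /=.
by rewrite -memvE.
Qed.

(** After division by [x], it suffices that [H] is not stable under multiplication by [y / x]: one
    product outside [H] spans [L] together with [H]. *)
Lemma hyperplane_mul (K : fieldType) (L : fieldExtType K) (H : {vspace L}) (x y z : L) :
  \dim {:L} = (\dim H).+1 -> x != 0 -> (forall c : K, y != c *: x) ->
  exists2 u, u \in H & exists2 v, v \in H & z = u * x + v * y.
Proof.
move=> dimH x0 yx.
have [v _ vH] : exists2 v, v \in {:L}%VS & v \notin H.
  apply/subvPn; apply/negP=> /dimvS; by rewrite dimH ltnn.
have decomp a b : b \notin H -> exists2 h, h \in H & exists e : K, a = h + e *: b.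
  move=> /(hyperplane_add dimH) HbL.
  have /memv_addP[h Hh [_ /vlineP[e ->] ->]] : a \in (H + <[b]>)%VS by rewrite HbL memvf.
  by exists h => //; exists e.
(* If multiplication by [y / x] preserved [H], then for some scalar [e] the
   nonzero multiplication by [y / x - e] would map the whole of [L] into [H]. *)
have [h Hh hcH] : exists2 h, h \in H & h * (y / x) \notin H.
  have [/existsP[i hi] | /existsPn noH] :=
    boolP [exists i : 'I_(\dim H), (vbasis H)`_i * (y / x) \notin H].
    exists (vbasis H)`_i => //; apply: vbasis_mem.
    by rewrite mem_nth // size_tuple.
  have HcH h : h \in H -> h * (y / x) \in H.
    move=> /coord_vbasis ->; rewrite mulr_suml; apply: memv_suml => i _.
    by rewrite -scalerAl memvZ //; have := noH i; rewrite negbK.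
  have [h0 Hh0 [e vc]] := decomp (v * (y / x)) v vH.
  have ce0 : y / x - e%:A != 0.
    apply: contraNneq (yx e) => /subr0_eq ce; apply/eqP.
    by rewrite -[LHS](divfK x0) ce mulr_algl.
  have [h Hh [e' vE]] := decomp (v / (y / x - e%:A)) v vH.
  (* With [r = y / x], multiplying the last decomposition by [r - e] gives
     [v = h * r - e *: h + e' *: h0], which lies in [H]. *)
  case/negP: (vH); rewrite -[v](divfK ce0) vE mulrDl -scalerAl !mulrBr !mulr_algr vc.
  by rewrite addrK memvD ?memvZ // memvB ?memvZ ?HcH.
have [h' Hh' [e zx]] := decomp (z / x) _ hcH.
exists h' => //; exists (e *: h); first by rewrite memvZ.
by rewrite -[LHS](divfK x0) zx mulrDl -!scalerAl -mulrA divfK.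
Qed.

(** * The action of the general linear group on flags *)

Section GeneralLinear.

Variables (F : finFieldType) (n : nat).
Hypothesis n_gt0 : (0 < n)%N.

Lemma GL_mx_unit (g : {'GL_n[F]}) : GL_mx g \in unitmx.
Proof. by move: g; case: n n_gt0 => // m _ g; rewrite /GL_mx conform_mx_id; apply: valP. Qed.

Lemma GL_mx1 : GL_mx (1%g : {'GL_n[F]}) = 1%:M.
Proof. by case: n n_gt0 => // m _; rewrite /GL_mx conform_mx_id. Qed.

Lemma GL_mxM (g h : {'GL_n[F]}) : GL_mx (g * h)%g = GL_mx g *m GL_mx h.
Proof. by move: g h; case: n n_gt0 => // m _ g h; rewrite /GL_mx !conform_mx_id. Qed.

Lemma GL_mx_inj : injective (@GL_mx F n).
Proof.
case: n n_gt0 => // m _ g h; rewrite /GL_mx !conform_mx_id; exact: val_inj.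
Qed.

Variable ty : seq nat.
Implicit Types (X Y : preflag F n ty) (T : {group {'GL_n[F]}}).

Lemma flag_act1 : (@flag_act F n ty)^~ 1%g =1 id.
Proof.
move=> X; apply: val_inj; rewrite /= GL_mx1 -[RHS]map_id.
by apply: eq_map => U; rewrite subspace_act1.
Qed.

Lemma flag_actM X : act_morph (@flag_act F n ty) X.
Proof.
move=> g h; apply: val_inj; rewrite /= -map_comp; apply: eq_map => U /=.
by rewrite GL_mxM subspace_actM.
Qed.

Lemma card_flag_orbit T X :
  #|flag_orbit T X| = (#|T| %/ #|[set h in T | flag_act X h == X]|)%N.
Proof.
pose to := TotalAction flag_act1 flag_actM.
have := card_orbit to T X; rewrite -divgS ?subsetIl // => ->.
congr (_ %/ _)%N; apply: eq_card => h; rewrite !inE sub1set inE.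
by [].
Qed.

Lemma flag_act_eqV X g h : (flag_act X g == flag_act X h) = (flag_act X (g * h^-1)%g == X).
Proof.
rewrite flag_actM; apply/eqP/eqP => [->|]; first by rewrite -flag_actM mulgV flag_act1.
by move=> eX; rewrite -[X in RHS]eX -!flag_actM -?mulgA mulVg mulg1.
Qed.

End GeneralLinear.

(** * Maximal subspace and flag distances *)

Section FlagDistance.

Variables (F : finFieldType) (n : nat) (ty : seq nat).
Implicit Types (X Y : preflag F n ty) (U V : {vspace 'rV[F]_n}).

Definition max_subspace_dist (d : nat) : nat := (2 * minn d (n - d))%N.

Lemma dim_row : \dim {:'rV[F]_n} = n.
Proof. by rewrite dimvf; apply: mul1n. Qed.

Lemma dim_row_le U : (\dim U <= n)%N.
Proof. by have := dimvS (subvf U); rewrite dim_row. Qed.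

(** For [d] the common dimension, the distance is both [2 * (d - \dim (U :&: V))] and
    [2 * (\dim (U + V) - d)]; the sum has dimension at most [n]. *)
Lemma subspace_dist_le U V :
  \dim U = \dim V -> (subspace_dist U V <= max_subspace_dist (\dim U))%N.
Proof.
move=> eUV; have := dimv_sum_cap U V; have := dim_row_le (U + V)%VS.
rewrite /subspace_dist /max_subspace_dist -eUV => /[swap].
move: (\dim U) (\dim (U + V)%VS) (\dim (U :&: V)%VS) => a b c; lia.
Qed.

(** A trivial intersection forces [2 * \dim U <= n], so the minimum is [\dim U]; dually, a full sum
    makes it [n - \dim U]. *)
Lemma subspace_dist_disjoint U V :
  \dim U = \dim V -> (U :&: V = 0)%VS -> subspace_dist U V = max_subspace_dist (\dim U).
Proof.
move=> eUV UV0; have := dimv_disjoint_sum UV0; have := dim_row_le (U + V)%VS.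
rewrite /subspace_dist /max_subspace_dist -eUV UV0 dimv0.
move: (\dim U) (\dim (U + V)%VS) => a b; lia.
Qed.

Lemma subspace_dist_full U V :
  \dim U = \dim V -> (U + V = fullv)%VS -> subspace_dist U V = max_subspace_dist (\dim U).
Proof.
move=> eUV UVf; have := dimv_sum_cap U V; have := dimvS (subvf U).
rewrite /subspace_dist /max_subspace_dist -eUV UVf dim_row.
move: (\dim U) (\dim (U :&: V)%VS) => a c; lia.
Qed.

Definition max_flag_dist : nat := (\sum_(d <- ty) max_subspace_dist d)%N.

Lemma max_flag_distE :
  (2 * (\sum_(t <- ty | 2 * t <= n) t + \sum_(t <- ty | 2 * t > n) (n - t)))%N
    = max_flag_dist.
Proof.
rewrite /max_flag_dist -big_distrr /=; congr (2 * _)%N.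
rewrite [RHS](bigID (fun t => 2 * t <= n)%N) /=; congr (_ + _)%N.
  by apply: eq_bigr => t le_t; lia.
by apply: eq_big => [t|t lt_t]; lia.
Qed.

Lemma flag_dim X (i : 'I_(size ty)) : is_flag X -> \dim (tnth X i) = ty`_i.
Proof.
case=> /(congr1 (nth 0%N ^~ i)) <- _.
by rewrite (nth_map 0%VS) ?size_tuple // (tnth_nth 0%VS).
Qed.

Lemma max_flag_dist_ord (X : preflag F n ty) :
  is_flag X -> max_flag_dist = (\sum_(i < size ty) max_subspace_dist (\dim (tnth X i)))%N.
Proof.
move=> flX; rewrite /max_flag_dist (big_nth 0%N) big_mkord.
by apply: eq_bigr => i _; rewrite flag_dim.
Qed.

Lemma flag_dist_le X Y : is_flag X -> is_flag Y -> (flag_dist X Y <= max_flag_dist)%N.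
Proof.
move=> flX flY; rewrite (max_flag_dist_ord flX); apply: leq_sum => i _.
by apply: subspace_dist_le; rewrite !flag_dim.
Qed.

Lemma flag_dist_max X Y : is_flag X -> is_flag Y ->
  flag_dist X Y = max_flag_dist <->
  forall i, subspace_dist (tnth X i) (tnth Y i) = max_subspace_dist (\dim (tnth X i)).
Proof.
move=> flX flY; rewrite (max_flag_dist_ord flX); split=> [eqD i|eqD]; last first.
  by apply: eq_bigr => i _.
have le i' : true -> (subspace_dist (tnth X i') (tnth Y i')
    <= max_subspace_dist (\dim (tnth X i')) ?=
    iff (subspace_dist (tnth X i') (tnth Y i') == max_subspace_dist (\dim (tnth X i'))))%N.
  by move=> _; split=> //; apply: subspace_dist_le; rewrite !flag_dim.
have [_] := leqif_sum le; rewrite -/(flag_dist X Y) eqD eqxx => /esym/forallP/(_ i).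
by move/eqP.
Qed.

(** The minimum is the head of a sorted list, and positivity of the bound rules out the default [0]
    of codes without two distinct elements. *)
Lemma optimum_distanceP (C : {set preflag F n ty}) :
  (forall X, X \in C -> is_flag X) -> (0 < max_flag_dist)%N ->
  optimum_distance C <->
  (exists X Y, [/\ X \in C, Y \in C & X != Y]) /\
  (forall X Y, X \in C -> Y \in C -> X != Y -> flag_dist X Y = max_flag_dist).
Proof.
move=> flC D_gt0; rewrite /optimum_distance max_flag_distE /min_flag_dist.
set s := [seq _ | _ in _].
have memP d : reflect (exists X Y, [/\ X \in C, Y \in C, X != Y & d = flag_dist X Y])
    (d \in sort leq s).
  rewrite mem_sort; apply: (iffP imageP) => [[[X Y] /and3P[/= XC YC XY] ->]|].
    by exists X, Y.
  by case=> X [Y [XC YC XY ->]]; exists (X, Y); rewrite // inE /= XC YC XY.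
have := sort_sorted leq_total s; case: (sort leq s) memP => [|d r] memP /= srt.
  split=> [D0|[[X [Y [XC YC XY]]] _]]; first by rewrite -D0 in D_gt0.
  have /memP : exists X' Y', [/\ X' \in C, Y' \in C, X' != Y' & flag_dist X Y = flag_dist X' Y'].
    by exists X, Y.
  by [].
split=> [dD|[_ allD]].
  split.
    by have /memP[X [Y [XC YC XY _]]] : d \in d :: r by [rewrite mem_head]; exists X, Y.
  move=> X Y XC YC XY; apply/eqP; rewrite eqn_leq flag_dist_le; try exact: flC.
  rewrite -dD /=.
  have /memP : exists X' Y', [/\ X' \in C, Y' \in C, X' != Y' & flag_dist X Y = flag_dist X' Y'].
    by exists X, Y.
  rewrite inE => /predU1P[->//|]; exact: (allP (order_path_min leq_trans srt)).
have /memP[X [Y [XC YC XY ->]]] : d \in d :: r by rewrite mem_head.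
exact: allD.
Qed.

Lemma flag_comparable X U V : is_flag X -> U \in X -> V \in X -> (U <= V)%VS || (V <= U)%VS.
Proof.
case=> _ srtX UX VX; have tr : transitive (fun U V : {vspace 'rV[F]_n} => (U <= V)%VS).
  by move=> ? ? ?; apply: subv_trans.
have leX := sorted_leq_nth tr (@subvv _ _) 0%VS srtX.
rewrite -(nth_index 0%VS UX) -(nth_index 0%VS VX).
have lt W : W \in X -> index W X \in [pred i | i < size X]%N by rewrite inE index_mem.
by have [le|/ltnW le] := leqP (index U X) (index V X); apply/orP;
  [left; apply: leX (lt _ UX) (lt _ VX) le | right; apply: leX (lt _ VX) (lt _ UX) le].
Qed.

Lemma flag_dim_sub X U V :
  is_flag X -> U \in X -> V \in X -> (\dim U <= \dim V)%N -> (U <= V)%VS.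
Proof.
move=> flX UX VX le; have /orP[//|VU] := flag_comparable flX UX VX.
suff /eqP -> : V == U by [].
by rewrite eqEdim VU.
Qed.

Lemma flag_componentP X d : is_flag X -> d \in ty ->
  flag_component X d \in X /\ \dim (flag_component X d) = d.
Proof.
case=> dimX _ dty; have lt : (index d ty < size X)%N by rewrite size_tuple index_mem.
split; first exact: mem_nth.
by rewrite /flag_component -(nth_map 0%VS 0%N (fun U => \dim U)) // dimX nth_index.
Qed.

Lemma is_flag_act X g : (0 < n)%N -> is_flag X -> is_flag (flag_act X g).
Proof.
move=> n0 [dimX srtX]; split.
  rewrite -[RHS]dimX /= -map_comp; apply: eq_map => U /=.
  by rewrite dim_subspace_act // GL_mx_unit.
by rewrite sorted_map; apply: sub_sorted srtX => U V; apply: subspace_actS.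
Qed.

End FlagDistance.

(** * Orbits of subgroups of the Singer cycle, in the model [L] *)

Section SingerCycle.

Variables (F : finFieldType) (K : fieldExtType F) (L : fieldExtType K) (n : nat).
(* [E] is an [F]-linear identification of the ambient space with [L]. *)
Variables (E : 'rV[F]_n -> L) (alpha : L) (g : {'GL_n[F]}).
Hypothesis n_gt0 : (0 < n)%N.
Hypothesis E_lin : forall a u v, E (a *: u + v) = (a%:A : K)%:A * E u + E v.
Hypotheses (E_inj : injective E) (E_surj : forall x, exists u, E u = x).
Hypotheses (alpha_neq0 : alpha != 0) (Eg : forall u, E (u *m GL_mx g) = E u * alpha).

Implicit Type U : {vspace 'rV[F]_n}.

Definition acts_by (h : {'GL_n[F]}) (b : L) : Prop :=
  b != 0 /\ forall u, E (u *m GL_mx h) = E u * b.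

Lemma modelZ a u : E (a *: u) = (a%:A : K)%:A * E u.
Proof.
have E0 : E 0 = 0.
  have := E_lin 1 0 0; rewrite scaler0 addr0 !scale1r mul1r => /eqP.
  by rewrite -subr_eq0 opprD addNKr oppr_eq0 => /eqP.
by have := E_lin a u 0; rewrite E0 !addr0.
Qed.

Lemma acts_by1 : acts_by 1%g 1.
Proof. by split=> [|u]; rewrite ?oner_eq0 // GL_mx1 // mulmx1 mulr1. Qed.

Lemma acts_byM h b h' b' : acts_by h b -> acts_by h' b' -> acts_by (h * h')%g (b * b').
Proof.
move=> [b0 hb] [b0' hb']; split=> [|u]; first by rewrite mulf_neq0.
by rewrite GL_mxM // mulmxA hb' hb mulrA.
Qed.

Lemma acts_byV h b : acts_by h b -> acts_by h^-1%g b^-1.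
Proof.
move=> [b0 hb]; split=> [|u]; first by rewrite invr_eq0.
by apply: (mulIf b0); rewrite divfK // -hb -mulmxA -GL_mxM // mulVg GL_mx1 // mulmx1.
Qed.

Lemma acts_byX h b m : acts_by h b -> acts_by (h ^+ m)%g (b ^+ m).
Proof.
move=> hb; elim: m => [|m IHm]; first exact: acts_by1.
by rewrite expgS exprS; apply: acts_byM.
Qed.

Lemma acts_by_cycle h : h \in <[g]>%g -> exists b, acts_by h b.
Proof. by case/cycleP=> i ->; exists (alpha ^+ i); apply: acts_byX. Qed.

(** Faithfulness of the model: power relations in the group can be tested on multipliers in [L]. *)
Lemma acts_by_eq1 h b : acts_by h b -> (h == 1%g) = (b == 1).
Proof.
move=> [b0 hb]; apply/eqP/eqP => [h1|b1].
  have [u u1] := E_surj 1.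
  by have := hb u; rewrite h1 GL_mx1 // mulmx1 u1 mul1r.
apply: (GL_mx_inj n_gt0); rewrite GL_mx1 //; apply/row_matrixP=> i.
by rewrite !rowE; apply: E_inj; rewrite hb b1 mulr1 mulmx1.
Qed.

Lemma acts_by_expg_eq1 h b m : acts_by h b -> (h ^+ m == 1)%g = (b ^+ m == 1).
Proof. by move=> hb; apply: acts_by_eq1; apply: acts_byX. Qed.

Lemma subspace_act_base h b (c : F) U :
  acts_by h b -> b = (c%:A : K)%:A -> subspace_act U (GL_mx h) = U.
Proof.
move=> [b0 hb] bc; apply: (@subspace_act_scalar _ _ _ _ c).
  by apply: contraNneq b0 => c0; rewrite bc c0 !scale0r.
by move=> u; apply: E_inj; rewrite hb modelZ bc mulrC.
Qed.

(** A generator [u] of the line is an eigenvector, say for [c]; cancelling [E u] in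
    [E u * b = c * E u] gives [b]. *)
Lemma line_stable h b U :
  acts_by h b -> \dim U = 1%N -> subspace_act U (GL_mx h) = U ->
  exists c : F, b = (c%:A : K)%:A.
Proof.
move=> [b0 hb] dimU Uh.
have [u Uu u0] : exists2 u, u \in U & u != 0.
  exists (vpick U); first exact: memv_pick.
  by rewrite vpick0 -dimv_eq0 dimU.
have U_u : U = <[u]>%VS.
  by apply/esym/eqP; rewrite eqEdim -memvE Uu dimU dim_vline u0.
have /vlineP[c uc] : u *m GL_mx h \in <[u]>%VS.
  by rewrite -U_u -Uh; apply/memv_subspace_act; exists u.
exists c; have Eu0 : E u != 0.
  apply: contraNneq u0 => Eu0; apply/eqP/E_inj.
  by rewrite -[0](scale0r u) modelZ Eu0 mulr0.
by apply: (mulfI Eu0); rewrite -hb uc modelZ mulrC.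
Qed.

(** [H] is closed under scalars from [K], so the image lies in [U], and dimensions agree. *)
Lemma subspace_act_extension h b (c : K) U (H : {vspace L}) :
  acts_by h b -> b = c%:A -> (forall u, (u \in U) = (E u \in H)) ->
  subspace_act U (GL_mx h) = U.
Proof.
move=> [b0 hb] bc UH; apply/eqP; rewrite eqEdim dim_subspace_act ?GL_mx_unit // leqnn andbT.
apply/subvP=> _ /memv_subspace_act[u Uu ->].
by rewrite UH hb bc mulr_algr memvZ // -UH.
Qed.

(** A nonzero common vector is [E a * x = E b * y] with [E a] and [E b] on one [K]-line, which puts
    [y / x] in [K]. *)
Lemma line_act_disjoint h h' x y U (H : {vspace L}) :
  acts_by h x -> acts_by h' y -> (forall c : K, y != c *: x) ->
  \dim H = 1%N -> (forall u, (u \in U) = (E u \in H)) ->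
  (subspace_act U (GL_mx h) :&: subspace_act U (GL_mx h') = 0)%VS.
Proof.
move=> [x0 hx] [y0 hy] yx dimH UH; apply/eqP; rewrite -subv0; apply/subvP=> v.
case/memv_capP=> /memv_subspace_act[a Ua va] /memv_subspace_act[b Ub vb].
have Eab : E a * x = E b * y by rewrite -hx -hy -va vb.
have [b0|b0] := eqVneq (E b) 0.
  rewrite memv0 va; have -> : a = 0; last by rewrite mul0mx.
  apply: E_inj; rewrite -[0](scale0r a) modelZ !scale0r mul0r.
  by apply/eqP; rewrite -(mulIr_eq0 _ (mulIf x0)) Eab b0 mul0r.
have H_b : H = <[E b]>%VS.
  by apply/esym/eqP; rewrite eqEdim -memvE -UH Ub dimH dim_vline b0.
have := Ua; rewrite UH H_b => /vlineP[c ac]; case/eqP: (yx c).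
by apply: (mulfI b0); rewrite -Eab ac -scalerAl -scalerAr.
Qed.

Lemma hyperplane_act_full h h' x y U (H : {vspace L}) :
  acts_by h x -> acts_by h' y -> (forall c : K, y != c *: x) ->
  \dim {:L} = (\dim H).+1 -> (forall u, (u \in U) = (E u \in H)) ->
  (subspace_act U (GL_mx h) + subspace_act U (GL_mx h') = fullv)%VS.
Proof.
move=> [x0 hx] [y0 hy] yx dimH UH; apply/eqP; rewrite eqEsubv subvf; apply/subvP=> v _.
have [a Ha [b Hb vab]] := hyperplane_mul (E v) dimH x0 yx.
have [a' aE] := E_surj a; have [b' bE] := E_surj b.
have -> : v = a' *m GL_mx h + b' *m GL_mx h'.
  by apply: E_inj; rewrite -[_ *m _ in RHS]scale1r E_lin !scale1r mul1r hx hy aE bE.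
by rewrite memv_add //; apply/memv_subspace_act; [exists a'|exists b']; rewrite // UH ?aE ?bE.
Qed.

Variables (ty : seq nat) (X : preflag F n ty) (T : {group {'GL_n[F]}}) (k : nat).
Hypotheses (dimK : \dim {:K} = k) (flX : is_flag X) (sTg : T \subset <[g]>%g).
Hypothesis ty1 : 1%N \in ty.

Lemma flag_act_eqP h : h \in <[g]>%g -> (flag_act X h == X) = (h ^+ (#|F| - 1) == 1)%g.
Proof.
move=> /acts_by_cycle[b hb]; rewrite (acts_by_expg_eq1 _ hb).
apply/eqP/eqP => [Xh|/expf_pred_base[_ [c bc]]]; last first.
  by apply: eq_from_tnth => i; rewrite tnth_map (subspace_act_base _ hb bc).
apply/expf_pred_base; split; first by case: hb.
have [/tnthP[i Xi] dim1] := flag_componentP flX ty1.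
by apply: (line_stable hb dim1); rewrite Xi -[in RHS]Xh tnth_map.
Qed.

Lemma card_singer_orbit : #|flag_orbit T X| = (#|T| %/ gcdn #|T| (#|F| - 1))%N.
Proof.
rewrite card_flag_orbit // -card_expg_eq1 ?(cyclicS sTg) ?cycle_cyclic //.
congr (_ %/ _)%N; apply: eq_card => h; rewrite !inE.
by have [Th|//] := boolP (h \in T); rewrite flag_act_eqP // (subsetP sTg).
Qed.

Hypotheses (ty_k : k \in ty) (ty_nk : (n - k)%N \in ty) (k_gt0 : (0 < k)%N) (k_ltn : (k < n)%N).
Hypothesis ty_le : forall d, d \in ty -> (d <= k)%N || (n - k <= d)%N.
Variables (H1 H2 : {vspace L}).
Hypotheses (dimH1 : \dim H1 = 1%N) (dimH2 : \dim {:L} = (\dim H2).+1).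
Hypothesis X_k : forall u, (u \in flag_component X k) = (E u \in H1).
Hypothesis X_nk : forall u, (u \in flag_component X (n - k)) = (E u \in H2).

Lemma max_flag_dist_gt0 : (0 < max_flag_dist n ty)%N.
Proof.
rewrite /max_flag_dist (big_rem k) //= ltn_addr // /max_subspace_dist; lia.
Qed.

(** Components of dimension at most [k] lie in the spread element and inherit trivial intersection;
    the others contain the hyperplane component and inherit a full sum. *)
Lemma flag_act_dist h h' x y :
  acts_by h x -> acts_by h' y -> (forall c : K, y != c *: x) ->
  flag_dist (flag_act X h) (flag_act X h') = max_flag_dist n ty.
Proof.
move=> hx hy yx; apply/flag_dist_max; try exact: is_flag_act.
move=> i; rewrite !tnth_map; set U := tnth X i.
have XU : U \in X by apply: mem_tnth.
have dimU : \dim (subspace_act U (GL_mx h)) = \dim (subspace_act U (GL_mx h')).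
  by rewrite !dim_subspace_act ?GL_mx_unit.
have [Xk dimXk] := flag_componentP flX ty_k.
have [Xnk dimXnk] := flag_componentP flX ty_nk.
have /orP[le|le] : (\dim U <= k)%N || (n - k <= \dim U)%N.
- by apply: ty_le; rewrite flag_dim // mem_nth.
- apply: subspace_dist_disjoint => //; apply/eqP.
  rewrite -subv0 -(line_act_disjoint hx hy yx dimH1 X_k).
  have sU : (U <= flag_component X k)%VS by apply: (flag_dim_sub flX); rewrite ?dimXk.
  by rewrite capvS ?subspace_actS.
- apply: subspace_dist_full => //; apply/eqP.
  rewrite eqEsubv subvf -(hyperplane_act_full hx hy yx dimH2 X_nk).
  have sU : (flag_component X (n - k) <= U)%VS by apply: (flag_dim_sub flX); rewrite ?dimXnk.
  by rewrite addvS ?subspace_actS.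
Qed.

(** The sets [Z (q - 1)] and [Z (q ^ k - 1)], with [q = #|F|], are nested, so equality of the gcds,
    which are their sizes, means equality of the sets. *)
Lemma optimum_singer_orbit :
  optimum_distance (flag_orbit T X) <->
  gcdn #|T| (#|F| ^ k - 1) = gcdn #|T| (#|F| - 1) /\ gcdn #|T| (#|F| - 1) <> #|T|.
Proof.
have cycT : cyclic T by rewrite (cyclicS sTg) ?cycle_cyclic.
have flO Y : Y \in flag_orbit T X -> is_flag Y.
  by case/imsetP=> h _ ->; apply: is_flag_act.
have t_gt0 := cardG_gt0 T.
have orbit_gt1 : (1 < #|flag_orbit T X|)%N <-> gcdn #|T| (#|F| - 1) <> #|T|.
  rewrite card_singer_orbit ltn_divRL ?dvdn_gcdl // mul1n ltn_neqAle.
  rewrite dvdn_leq ?dvdn_gcdl // andbT; split; [by move/eqP|by move=> ?; apply/eqP].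
pose Z m := [set h in T | h ^+ m == 1]%g.
have cardZ m : #|Z m| = gcdn #|T| m by apply: card_expg_eq1.
have sZ : Z (#|F| - 1)%N \subset Z (#|F| ^ k - 1)%N.
  apply/subsetP=> h; rewrite !inE -!order_dvdn => /andP[-> /=] /dvdn_trans; apply.
  exact: dvdn_subn_expn.
rewrite (optimum_distanceP flO max_flag_dist_gt0) -!cardZ in orbit_gt1 *.
split=> [[[Y [Y' [OY OY' YY']]] maxO]|[cardZE /orbit_gt1 O_gt1]].
  split; last first.
    by apply/orbit_gt1; rewrite (cardsD1 Y) (cardsD1 Y') OY !inE eq_sym YY' OY'.
  apply/eqP; rewrite eqn_leq (subset_leq_card sZ) andbT subset_leq_card //.
  apply/subsetP=> h; rewrite !inE => /andP[Th hk]; rewrite Th /=.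
  have gh : h \in <[g]>%g := subsetP sTg h Th.
  (* If [h] moved the flag, then [X] and its image would be distinct codewords; yet the multiplier
     of [h] lies in [K], so they share the component of dimension [k], against maximal distance. *)
  rewrite -flag_act_eqP //; apply/eqP; apply: contraTeq isT => Xh.
  have [b hb] := acts_by_cycle gh.
  rewrite (acts_by_expg_eq1 _ hb) -dimK in hk.
  have [_ [c bc]] := (expf_pred_subfield b).1 (eqP hk).
  have OX : X \in flag_orbit T X by apply/imsetP; exists 1%g; rewrite ?flag_act1.
  have OXh : flag_act X h \in flag_orbit T X by apply: imset_f.
  have := maxO _ _ OXh OX Xh; rewrite (flag_dist_max (flO _ OXh) flX).
  have [/tnthP[i Xi] dimk] := flag_componentP flX ty_k.
  move/(_ i); rewrite tnth_map -Xi (subspace_act_extension hb bc X_k).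
  rewrite /subspace_dist addvv capvv subnn dimk /max_subspace_dist => D0.
  by move: D0 k_gt0 k_ltn; clear; lia.
have eqZ : Z (#|F| ^ k - 1)%N = Z (#|F| - 1)%N.
  by apply/eqP; rewrite eq_sym eqEcard sZ cardZE /=.
split; first by have /card_gt1P[Y [Y' [? ? ?]]] := O_gt1; exists Y, Y'.
move=> _ _ /imsetP[h Th ->] /imsetP[h' Th' ->] neq.
have [x hx] := acts_by_cycle (subsetP sTg h Th).
have [y hy] := acts_by_cycle (subsetP sTg h' Th').
apply: (flag_act_dist hx hy) => c; apply: contraNneq neq => yc.
(* If [y = c *: x], then [h * h'^-1] acts by [c^-1] in [K], hence lies in
   [Z (q ^ k - 1) = Z (q - 1)] and fixes the flag. *)
have Thh : (h * h'^-1)%g \in T by rewrite groupM ?groupV.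
rewrite flag_act_eqV // flag_act_eqP ?(subsetP sTg) //.
suff : (h * h'^-1)%g \in Z (#|F| ^ k - 1)%N by rewrite eqZ inE => /andP[].
have hh := acts_byM hx (acts_byV hy).
rewrite inE Thh (acts_by_expg_eq1 _ hh) -dimK; apply/eqP/expf_pred_subfield.
split; first by case: hh.
have c0 : c != 0 by apply: contraNneq (hy.1) => c0; rewrite yc c0 scale0r.
exists c^-1; rewrite yc -[c *: x]mulr_algl invfM mulrCA divff ?mulr1 ?(hx.1) //.
by rewrite -[c%:A]/(in_alg L c) -fmorphV.
Qed.

End SingerCycle.

(** * The given flag type and the transfer to the model *)

Lemma mem_full_type (k n d : nat) :
  (d \in full_type k n) = (1 <= d <= k)%N || (n - k <= d < n - k + k)%N.
Proof. by rewrite mem_undup mem_cat !mem_iota add1n ltnS. Qed.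

Theorem theorem5p1
  (F : finFieldType) (K : fieldExtType F) (L : fieldExtType K) (k s : nat)
  (hk : \dim {:K} = k) (hs : \dim {:L} = s) (s_ge2 : (2 <= s)%N)
  (w : K) (hw : primitive_element w)
  (p : {poly F}) (hp : map_poly (in_alg K) p = minPoly 1%VS w)
  (alpha : L) (halpha : primitive_element alpha)
  (P : {poly K}) (hP : map_poly (in_alg L) P = minPoly 1%VS alpha)
  (g : {'GL_(k * s)[F]}) (hg : GL_mx g = psi k w p (companion s P))
  (Fl : preflag F (k * s) (full_type k (k * s))) (hFl : is_flag Fl)
  (hS : in_spread w p (flag_component Fl k))
  (hH : in_hyperplanes w p (flag_component Fl (k * s - k)))
  (t : nat) (t_gt0 : (0 < t)%N) (ht : (t %| #|F| ^ (k * s) - 1)%N)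
  (T : {group {'GL_(k * s)[F]}}) (hT : T \subset <[g]>%g) (cardT : #|T| = t) :
  #|flag_orbit T Fl| = (t %/ gcdn t (#|F| - 1))%N /\
  (optimum_distance (flag_orbit T Fl) <->
   gcdn t (#|F| ^ k - 1) = gcdn t (#|F| - 1) /\ gcdn t (#|F| - 1) <> t).
Proof.
have k_gt0 : (0 < k)%N by rewrite -hk adim_gt0.
have k_ltn : (k < k * s)%N by rewrite -{1}[k]muln1 ltn_pmul2l.
have n_gt0 : (0 < k * s)%N by apply: ltn_trans k_ltn.
(* Two stages: blocks over [F] become elements of [K] through powers of [w], then [s] of these
   become one element of [L] through powers of [alpha]. *)
pose E (u : 'rV[F]_(k * s)) : L := horner_row alpha (unreduce w u).
have E_lin a u v : E (a *: u + v) = (a%:A : K)%:A * E u + E v.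
  by rewrite /E unreduceP linearP mulr_algl.
have E_inj : injective E.
  exact: inj_comp (can_inj (horner_rowK hs halpha)) (unreduce_inj hk hw (s := s)).
have E_surj x : exists u, E u = x.
  have [u eu] := unreduce_surj hk hw (coord_row s alpha x).
  by exists u; rewrite /E eu (coord_rowK hs halpha).
have Eg u : E (u *m GL_mx g) = E u * alpha.
  by rewrite /E hg (unreduce_psi hk hw hp) (horner_row_companion hs halpha hP).
(* Subspaces in the image of [varphi] correspond under [E] to [K]-subspaces of [L]: [W] is carried
   over along the powers of [alpha]. *)
have imageP d U : in_varphi_image w p d U ->
    exists2 H : {vspace L}, \dim H = d & forall u, (u \in U) = (E u \in H).
  case=> W dimW ->; exists (linfun (@horner_row K L s alpha) @: W)%VS.
    rewrite limg_dim_eq ?dimW //; apply/eqP; rewrite -subv0; apply/subvP=> x.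
    case/memv_capP=> _; rewrite memv_ker lfunE /= memv0 => /eqP x0.
    by apply/eqP/(can_inj (horner_rowK hs halpha)); rewrite x0 linear0.
  move=> u; rewrite (memv_varphi hk hw hp); apply/idP/memv_imgP.
    by exists (unreduce w u); rewrite // lfunE.
  by case=> x Wx; rewrite lfunE /= => /(can_inj (horner_rowK hs halpha)) ->.
have [H1 dimH1 X_k] := imageP _ _ hS.
have [H2 dimH2 X_nk] := imageP _ _ hH.
have {}dimH2 : \dim {:L} = (\dim H2).+1 by rewrite hs dimH2 prednK // ltnW.
have alpha0 : alpha != 0 by case: halpha.
have ty1 : 1%N \in full_type k (k * s) by rewrite mem_full_type k_gt0.
have ty_k : k \in full_type k (k * s) by rewrite mem_full_type k_gt0 leqnn.
have ty_nk : (k * s - k)%N \in full_type k (k * s).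
  by rewrite mem_full_type; apply/orP; right; rewrite leqnn /= -addn1 leq_add2l.
have ty_le d : d \in full_type k (k * s) -> (d <= k)%N || (k * s - k <= d)%N.
  by rewrite mem_full_type => /orP[/andP[_ ->]|/andP[-> _]]; rewrite ?orbT.
rewrite -cardT; split.
  exact: (card_singer_orbit n_gt0 E_lin E_inj E_surj alpha0 Eg hFl hT ty1).
exact: (optimum_singer_orbit n_gt0 E_lin E_inj E_surj alpha0 Eg hk hFl hT ty1
  ty_k ty_nk k_gt0 k_ltn ty_le dimH1 dimH2 X_k X_nk).
Qed.
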